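(* Let $S$ be a pseudocomplemented semiring. Let $P$ be a prime ideal of $S$ with the property that, for every $s\in S$, $s\in P$ implies $s^* \notin P$. Then the following statements hold: (1) If $s\in P$, then $s^{**} \in P$. (2) $P$ is a minimal prime ideal of $S$.
   Context: A semiring is a set $S$ with operations $+,\cdot$ such that $(S,+)$ is a commutative monoid with identity $0$, $(S,\cdot)$ is a commutative monoid with identity $1\neq 0$, multiplication distributes over addition, and $s\cdot 0=0$ for all $s\in S$. An ordered semiring is a semiring with a partial order $\leq$ such that $s\leq t$ implies $s+u\leq t+u$ for all $u$, and $s\leq t$, $0\leq u$ imply $su\leq tu$. In an ordered semiring $S$, an element $s$ is pseudocomplemented if there is an element $s^*\in S$ (necessarily unique, called the pseudocomplement of $s$) such that $ss^*=0$ and, for each $x\in S$, $sx=0$ implies $x\leq s^*$. A pseudocomplemented semiring is an ordered semiring all of whose elements are pseudocomplemented. Write $s^{**}=(s^* )^*$. A nonempty subset $I\subseteq S$ is an ideal if $a+b\in I$ and $sa\in I$ for all $a,b\in I$, $s\in S$. An ideal $P\neq S$ is prime if $ab\in P$ implies $a\in P$ or $b\in P$. A minimal prime ideal of $S$ is a prime ideal that is minimal with respect to inclusion among all prime ideals of $S$. *)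

(* Defs.v *)
From HB Require Import structures.
From mathcomp Require Import all_boot all_algebra.
From mathcomp Require Import boolp classical_sets.

Set Implicit Arguments.
Unset Strict Implicit.
Unset Printing Implicit Defensive.

Import GRing.Theory.

Local Open Scope classical_set_scope.
Local Open Scope ring_scope.

(* The order is part of the mixin rather than inherited from Order.POrder:     *)
(* HB rejects a join of ComNzSemiRing and POrder, because mathcomp already      *)
(* joins their bases in Num.POrderedZmodule, which has opposites.               *)
(* The choiceType structure and the boolean order cost no generality, by        *)
(* boolp.gen_choiceMixin and boolp.asbool.                                      *)
HB.mixin Record isOrderedSemiring T of GRing.ComNzSemiRing T := {
  osr_le : rel T;
  osr_le_refl : reflexive osr_le;
  osr_le_anti : antisymmetric osr_le;
  osr_le_trans : transitive osr_le;
  osr_leD2r : forall s t u : T, osr_le s t -> osr_le (s + u) (t + u);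
  osr_leM2r : forall s t u : T,
    osr_le s t -> osr_le 0 u -> osr_le (s * u) (t * u)
}.

#[short(type="orderedSemiringType")]
HB.structure Definition OrderedSemiring :=
  { T of isOrderedSemiring T & GRing.ComNzSemiRing T }.

Definition is_pseudocomplement (S : orderedSemiringType) (s t : S) : Prop :=
  s * t = 0 /\ forall x : S, s * x = 0 -> osr_le x t.

Definition pseudocomplemented (S : orderedSemiringType) : Prop :=
  forall s : S, exists t : S, is_pseudocomplement s t.

(* The default value 0 is only taken at elements with no pseudocomplement.     *)
Definition pseudocomplement (S : orderedSemiringType) (s : S) : S :=
  xget 0 [set t | is_pseudocomplement s t].

Lemma is_pseudocomplement_unique (S : orderedSemiringType) (s t u : S) :
  is_pseudocomplement s t -> is_pseudocomplement s u -> t = u.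
Proof.
by move=> [st0 tmax] [su0 umax]; apply: osr_le_anti; rewrite umax // tmax.
Qed.

Lemma pseudocomplementP (S : orderedSemiringType) (s : S) :
  pseudocomplemented S -> is_pseudocomplement s (pseudocomplement s).
Proof. by move=> /(_ s); exact: xgetPex. Qed.

Definition is_ideal (S : comNzSemiRingType) (I : set S) : Prop :=
  [/\ I !=set0,
      forall a b : S, I a -> I b -> I (a + b)
    & forall s a : S, I a -> I (s * a)].

Definition is_prime_ideal (S : comNzSemiRingType) (P : set S) : Prop :=
  [/\ is_ideal P, P <> setT
    & forall a b : S, P (a * b) -> P a \/ P b].

Definition is_minimal_prime_ideal (S : comNzSemiRingType) (P : set S) : Prop :=
  is_prime_ideal P /\
  forall Q : set S, is_prime_ideal Q -> Q `<=` P -> Q = P.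

(* Main.v *)
(** A prime ideal contains [0 = s s^*], so it contains [s] or [s^*].  Applied to
    [P] and [s^*], this gives (1), as [s^*] is not in [P].  Applied to a prime
    ideal [Q] contained in [P] and to [s] in [P], it puts [s] in [Q]. *)
Require Import Defs.
From mathcomp Require Import all_boot all_algebra.
From mathcomp Require Import boolp classical_sets.

(** Nonemptiness supplies some [a] in [I], and absorption then puts [0 * a = 0] in [I]. *)
Lemma ideal0 (S : comNzSemiRingType) (I : set S) :
  is_ideal I -> I (GRing.zero : S).
Proof. by case=> [[a Ia] _ /(_ GRing.zero a Ia)]; rewrite GRing.mul0r. Qed.

Lemma prime_ideal_pseudocomplement (S : orderedSemiringType)
    (hS : pseudocomplemented S) (P : set S) (s : S) :
  is_prime_ideal P -> P s \/ P (pseudocomplement s).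
Proof.
case=> idP _ primeP; apply: primeP.
by have [-> _] := pseudocomplementP s hS; exact: ideal0.
Qed.

Theorem corollary2p8 (S : orderedSemiringType)
    (hS : pseudocomplemented S) (P : set S) (hP : is_prime_ideal P)
    (hPs : forall s : S, P s -> ~ P (pseudocomplement s)) :
  (forall s : S, P s -> P (pseudocomplement (pseudocomplement s))) /\
  is_minimal_prime_ideal P.
Proof.
split=> [s Ps|].
  (* The case of [s^*] in [P] contradicts [hPs]; the other case is the goal. *)
  by have [/(hPs s Ps)|] := prime_ideal_pseudocomplement S hS P (pseudocomplement s) hP.
split=> // Q hQ QP; rewrite eqEsubset; split=> // s Ps.
(* If [s^*] were in [Q], the inclusion [QP] would place it in [P] together with [s], which [hPs]
   forbids. *)
by have [//|/QP /(hPs s Ps)] := prime_ideal_pseudocomplement S hS Q s hQ.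
Qed.
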